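(* Let $\Psi$ be any set of good $\mathcal{L}_\bullet$-sequents. Then the following hold. (1) A consecution $\Gamma\vdash\phi$ is derivable in $\mathsf{G_{BDFNL}}(\odot\Psi)$ if and only if $\mathsf{Alg}^+(\Psi)\models\Gamma\vdash\phi$. (2) If, for each sequent $\chi\vdash\delta$ in $\Psi$, every propositional variable occurring in $\delta$ also occurs in $\chi$, then $\mathsf{G_{BDFNL}}(\odot\Psi)$ has the subformula property: in any derivation of a consecution $\Gamma\vdash\phi$, all formulas occurring are subformulas of $\Gamma,\phi$.
   Context: $\mathcal{L}_{\mathrm{LC}}$-formulas are built from propositional variables and $\top,\bot$ using $\wedge,\vee,\to,\bullet,\leftarrow$; $\mathcal{L}_\bullet$-formulas are built from propositional variables and $\top,\bot$ using only $\bullet$. An $\mathcal{L}_\bullet$-sequent $\chi\vdash\delta$ ($\chi,\delta$ $\mathcal{L}_\bullet$-formulas) is good if each propositional variable occurs at most once in $\chi$. Structures: $\Gamma::=\phi\mid(\Gamma\odot\Gamma)\mid(\Gamma\barwedge\Gamma)$ with $\phi$ an $\mathcal{L}_{\mathrm{LC}}$-formula. A consecution is $\Gamma\vdash\phi$ with $\Gamma$ a structure and $\phi$ an $\mathcal{L}_{\mathrm{LC}}$-formula. A context $\Gamma[-]$ is a structure with a hole, and $\Gamma[\Delta]$ is the result of filling the hole with the structure $\Delta$. The formula $\tau(\Gamma)$ is defined by $\tau(\phi)=\phi$, $\tau(\Gamma\odot\Delta)=\tau(\Gamma)\bullet\tau(\Delta)$, $\tau(\Gamma\barwedge\Delta)=\tau(\Gamma)\wedge\tau(\Delta)$.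 $\mathsf{G_{BDFNL}}$ has: Axioms: $\phi\vdash\phi$; $\Gamma\vdash\top$; $\Gamma[\bot]\vdash\phi$. Logical rules: from $\Delta\vdash\phi$ and $\Gamma[\psi]\vdash\gamma$ infer $\Gamma[\Delta\odot(\phi\to\psi)]\vdash\gamma$; from $\phi\odot\Gamma\vdash\psi$ infer $\Gamma\vdash\phi\to\psi$; from $\Gamma[\phi]\vdash\gamma$ and $\Delta\vdash\psi$ infer $\Gamma[(\phi\leftarrow\psi)\odot\Delta]\vdash\gamma$; from $\Gamma\odot\psi\vdash\phi$ infer $\Gamma\vdash\phi\leftarrow\psi$; from $\Gamma[\phi\odot\psi]\vdash\gamma$ infer $\Gamma[\phi\bullet\psi]\vdash\gamma$; from $\Gamma\vdash\phi$ and $\Delta\vdash\psi$ infer $\Gamma\odot\Delta\vdash\phi\bullet\psi$; from $\Gamma[\phi\barwedge\psi]\vdash\gamma$ infer $\Gamma[\phi\wedge\psi]\vdash\gamma$; from $\Gamma\vdash\phi$ and $\Delta\vdash\psi$ infer $\Gamma\barwedge\Delta\vdash\phi\wedge\psi$; from $\Gamma[\phi]\vdash\gamma$ and $\Gamma[\psi]\vdash\gamma$ infer $\Gamma[\phi\vee\psi]\vdash\gamma$; from $\Gamma\vdash\phi_i$ infer $\Gamma\vdash\phi_1\vee\phi_2$ ($i=1,2$). Structural rules: from $\Gamma[\Delta\barwedge\Delta]\vdash\phi$ infer $\Gamma[\Delta]\vdash\phi$; from $\Gamma[\Delta]\vdash\phi$ infer $\Gamma[\Sigma\barwedge\Delta]\vdash\phi$;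 from $\Gamma[\Delta\barwedge\Lambda]\vdash\phi$ infer $\Gamma[\Lambda\barwedge\Delta]\vdash\phi$; from $\Gamma[(\Delta_1\barwedge\Delta_2)\barwedge\Delta_3]\vdash\phi$ infer $\Gamma[\Delta_1\barwedge(\Delta_2\barwedge\Delta_3)]\vdash\phi$. For an $\mathcal{L}_\bullet$-sequent $(\sigma)\ \chi\vdash\delta$ with propositional variables among $p_1,\dots,p_n$, the structural rule $(\odot\sigma)$ is: from $\Gamma[\delta[\Delta_1/p_1,\dots,\Delta_n/p_n]]\vdash\phi$ infer $\Gamma[\chi[\Delta_1/p_1,\dots,\Delta_n/p_n]]\vdash\phi$, where $\Delta_1,\dots,\Delta_n$ are arbitrary structures and $\delta[\Delta_1/p_1,\dots]$, $\chi[\Delta_1/p_1,\dots]$ are the structures obtained by uniformly substituting $\Delta_i$ for $p_i$ and $\odot$ for $\bullet$. $\mathsf{G_{BDFNL}}(\odot\Psi)$ is $\mathsf{G_{BDFNL}}$ extended with the rules $(\odot\sigma)$ for all $\sigma\in\Psi$. A bounded distributive lattice-ordered residuated groupoid (BDRG) is an algebra $(A,\wedge,\vee,\top,\bot,\to,\bullet,\leftarrow)$ such that $(A,\wedge,\vee,\top,\bot)$ is a bounded distributive lattice and, for all $a,b,c\in A$: $a\bullet b\le c$ iff $b\le a\to c$ iff $a\le c\leftarrow b$. A consecution $\Gamma\vdash\phi$ is valid in a BDRG if $\mu(\tau(\Gamma))\le\mu(\phi)$ for every assignment $\mu$ in it. $\mathsf{Alg}^+(\Psi)$ is the class of all BDRGs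 in which every sequent of $\Psi$ is valid, and $\mathsf{Alg}^+(\Psi)\models\Gamma\vdash\phi$ means that $\Gamma\vdash\phi$ is valid in every member of this class.
   Formalization: In (1), ''valid implies derivable'' is proved only when ⊤ occurs in no antecedent χ of Ψ (false for ⊤•p ⊢ p). In (2), a formula in a derivation may also be a constant ⊤ or ⊥ that occurs in δ but not in χ for some χ ⊢ δ in Ψ (false otherwise for p ⊢ ⊤•p). *)

(* Defs.v *)
From HB Require Import structures.
From mathcomp Require Import all_boot all_order.

Set Implicit Arguments.
Unset Strict Implicit.
Unset Printing Implicit Defensive.

Import Order.TTheory.

(* Formulas.  [Under a b] is a -> b and [Over a b] is a <- b, so that in a
   residuated algebra  b <= under a c,  fuse a b <= c  and  a <= over c b
   are equivalent. *)
Inductive formula :=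
  | Var of nat
  | Top
  | Bot
  | And of formula & formula
  | Or of formula & formula
  | Under of formula & formula
  | Fuse of formula & formula
  | Over of formula & formula.

Fixpoint subformula (a b : formula) : Prop :=
  a = b \/
  match b with
  | And b1 b2 | Or b1 b2 | Under b1 b2 | Fuse b1 b2 | Over b1 b2 =>
      subformula a b1 \/ subformula a b2
  | _ => False
  end.

(* Formulas built from variables and constants using only fusion. *)
Inductive bformula :=
  | BVar of nat
  | BTop
  | BBot
  | BFuse of bformula & bformula.

Fixpoint formula_of (x : bformula) : formula :=
  match x with
  | BVar n => Var n
  | BTop => Top
  | BBot => Bot
  | BFuse x y => Fuse (formula_of x) (formula_of y)
  end.

(* Variables, listed with multiplicity. *)
Fixpoint bvars (x : bformula) : seq nat :=
  match x with
  | BVar n => [:: n]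
  | BTop | BBot => [::]
  | BFuse x y => bvars x ++ bvars y
  end.

Record bsequent := BSequent { bant : bformula; bsuc : bformula }.

Definition good (s : bsequent) : Prop := uniq (bvars (bant s)).

Inductive structure :=
  | SForm of formula
  | SFuse of structure & structure
  | SMeet of structure & structure.

Coercion SForm : formula >-> structure.

Record consecution := Consecution { cant : structure; csuc : formula }.

Notation "G |-- a" := (Consecution G a) (at level 70, no associativity).

Fixpoint tau (G : structure) : formula :=
  match G with
  | SForm a => a
  | SFuse G D => Fuse (tau G) (tau D)
  | SMeet G D => And (tau G) (tau D)
  end.

Inductive context :=
  | Hole
  | CFuseL of context & structure
  | CFuseR of structure & context
  | CMeetL of context & structure
  | CMeetR of structure & context.

Fixpoint plug (C : context) (D : structure) : structure :=
  match C with
  | Hole => D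
  | CFuseL C G => SFuse (plug C D) G
  | CFuseR G C => SFuse G (plug C D)
  | CMeetL C G => SMeet (plug C D) G
  | CMeetR G C => SMeet G (plug C D)
  end.

(* Uniform substitution of structures for variables, fusion becoming the
   structural connective [SFuse]; the constants stay as formulas. *)
Fixpoint bsubst (S : nat -> structure) (x : bformula) : structure :=
  match x with
  | BVar n => S n
  | BTop => Top
  | BBot => Bot
  | BFuse x y => SFuse (bsubst S x) (bsubst S y)
  end.

(* [rule Psi ps c]: c follows from the premises ps by one rule of the calculus
   extended with the structural rules of the members of Psi. *)
Inductive rule (Psi : bsequent -> Prop) : seq consecution -> consecution -> Prop :=
  | R_id (a : formula) :
      rule Psi [::] (a |-- a)
  | R_top G :
      rule Psi [::] (G |-- Top)
  | R_bot C (a : formula) :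
      rule Psi [::] (plug C Bot |-- a)
  | R_underL C D (a b c : formula) :
      rule Psi [:: D |-- a; plug C b |-- c] (plug C (SFuse D (Under a b)) |-- c)
  | R_underR G (a b : formula) :
      rule Psi [:: SFuse a G |-- b] (G |-- Under a b)
  | R_overL C D (a b c : formula) :
      rule Psi [:: plug C a |-- c; D |-- b] (plug C (SFuse (Over a b) D) |-- c)
  | R_overR G (a b : formula) :
      rule Psi [:: SFuse G b |-- a] (G |-- Over a b)
  | R_fuseL C (a b c : formula) :
      rule Psi [:: plug C (SFuse a b) |-- c] (plug C (Fuse a b) |-- c)
  | R_fuseR G D (a b : formula) :
      rule Psi [:: G |-- a; D |-- b] (SFuse G D |-- Fuse a b)
  | R_andL C (a b c : formula) :
      rule Psi [:: plug C (SMeet a b) |-- c] (plug C (And a b) |-- c)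
  | R_andR G D (a b : formula) :
      rule Psi [:: G |-- a; D |-- b] (SMeet G D |-- And a b)
  | R_orL C (a b c : formula) :
      rule Psi [:: plug C a |-- c; plug C b |-- c] (plug C (Or a b) |-- c)
  | R_orR1 G (a b : formula) :
      rule Psi [:: G |-- a] (G |-- Or a b)
  | R_orR2 G (a b : formula) :
      rule Psi [:: G |-- b] (G |-- Or a b)
  | R_contraction C D (c : formula) :
      rule Psi [:: plug C (SMeet D D) |-- c] (plug C D |-- c)
  | R_weakening C D E (c : formula) :
      rule Psi [:: plug C D |-- c] (plug C (SMeet E D) |-- c)
  | R_exchange C D E (c : formula) :
      rule Psi [:: plug C (SMeet D E) |-- c] (plug C (SMeet E D) |-- c)
  | R_assoc C D1 D2 D3 (c : formula) :
      rule Psi [:: plug C (SMeet (SMeet D1 D2) D3) |-- c]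
               (plug C (SMeet D1 (SMeet D2 D3)) |-- c)
  | R_struct s C S (c : formula) : Psi s ->
      rule Psi [:: plug C (bsubst S (bsuc s)) |-- c]
               (plug C (bsubst S (bant s)) |-- c).

(* No rule has more than two premises. *)
Inductive derivation (Psi : bsequent -> Prop) : consecution -> Type :=
  | Infer0 c : rule Psi [::] c -> derivation Psi c
  | Infer1 c c1 : rule Psi [:: c1] c -> derivation Psi c1 -> derivation Psi c
  | Infer2 c c1 c2 : rule Psi [:: c1; c2] c ->
      derivation Psi c1 -> derivation Psi c2 -> derivation Psi c.

Definition derivable (Psi : bsequent -> Prop) (c : consecution) : Prop :=
  inhabited (derivation Psi c).

Fixpoint occurs_in_structure (a : formula) (G : structure) : Prop :=
  match G with
  | SForm b => a = b
  | SFuse G D | SMeet G D => occurs_in_structure a G \/ occurs_in_structure a D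
  end.

Definition occurs_in_consecution (a : formula) (c : consecution) : Prop :=
  occurs_in_structure a (cant c) \/ a = csuc c.

Fixpoint occurs_in_derivation (Psi : bsequent -> Prop) (a : formula)
    (c : consecution) (d : derivation Psi c) : Prop :=
  occurs_in_consecution a c \/
  match d with
  | Infer0 _ _ => False
  | Infer1 _ _ _ d1 => occurs_in_derivation a d1
  | Infer2 _ _ _ _ d1 d2 => occurs_in_derivation a d1 \/ occurs_in_derivation a d2
  end.

Definition subformula_of_consecution (a : formula) (c : consecution) : Prop :=
  exists2 b, occurs_in_consecution b c & subformula a b.

(* A structural rule whose succedent contains a constant missing from its
   antecedent has that constant, as a formula, in its premise but possibly not
   in its conclusion, whatever the variables do.  These are the constants
   that can disappear in this way. *)
Definition vanishing_constant (Psi : bsequent -> Prop) (a : formula) : Prop :=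
  (a = Top \/ a = Bot) /\
  exists2 s, Psi s &
    subformula a (formula_of (bsuc s)) /\ ~ subformula a (formula_of (bant s)).

HB.mixin Record isResiduatedGroupoid (d : Order.disp_t) T
    of Order.TBDistrLattice d T := {
  fuse : T -> T -> T;
  under : T -> T -> T;
  over : T -> T -> T;
  le_fuse_under : forall a b c : T, (fuse a b <= c)%O = (b <= under a c)%O;
  le_fuse_over : forall a b c : T, (fuse a b <= c)%O = (a <= over c b)%O
}.

#[short(type="bdrgType")]
HB.structure Definition BDRG (d : Order.disp_t) :=
  { T of Order.TBDistrLattice d T & isResiduatedGroupoid d T }.

Fixpoint eval (d : Order.disp_t) (A : bdrgType d) (mu : nat -> A) (a : formula) : A :=
  match a with
  | Var n => mu n
  | Top => Order.top
  | Bot => Order.bottom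
  | And a b => Order.meet (eval mu a) (eval mu b)
  | Or a b => Order.join (eval mu a) (eval mu b)
  | Under a b => under (eval mu a) (eval mu b)
  | Fuse a b => fuse (eval mu a) (eval mu b)
  | Over a b => over (eval mu a) (eval mu b)
  end.

Definition valid_in (d : Order.disp_t) (A : bdrgType d) (c : consecution) : Prop :=
  forall mu : nat -> A, (eval mu (tau (cant c)) <= eval mu (csuc c))%O.

Definition in_Alg (Psi : bsequent -> Prop) (d : Order.disp_t) (A : bdrgType d) : Prop :=
  forall s, Psi s -> valid_in A (formula_of (bant s) |-- formula_of (bsuc s)).

Definition Alg_entails (Psi : bsequent -> Prop) (c : consecution) : Prop :=
  forall (d : Order.disp_t) (A : bdrgType d), in_Alg Psi A -> valid_in A c.

(* Main.v *)
From Stdlib Require List.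
From HB Require Import structures.
Require Import Defs.
From mathcomp Require Import all_boot all_order.
From mathcomp Require Import boolp.

Set Implicit Arguments.
Unset Strict Implicit.
Unset Printing Implicit Defensive.

Import Order.TTheory.

(** Soundness: a context acts on a residuated algebra as a map that is
    monotone, preserves binary joins and preserves the bottom element.  This
    validates every rule with a context, distributivity being what the
    left rule for disjunction needs inside a meet; a structural rule is
    validated by evaluating its sequent at the values of the substituted
    structures.

    Completeness uses no cut elimination.  Call a set X of structures closed
    when z belongs to X as soon as, for all C and a, C[z] |-- a is derivable
    whenever C[y] |-- a is derivable for every y in X.  The structural rules
    for meet turn the lattice of closed sets into a distributive one, and the
    two structural connectives make it a residuated algebra
    ([closed_set_meetUl], [closed_set_le_fuse_under],
    [closed_set_le_fuse_over]).  A good sequent without Top in its antecedent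
    is valid there when its structural rule is present: by linearity, the value
    of its antecedent is generated by the substitution instances of that
    antecedent ([eval_antecedent_clos]).  Now let each variable denote the
    set of structures that derive it.  The logical rules say precisely that the
    value of a formula a contains a and consists of structures deriving a
    ([truth_lemma]).  Thus, if G |-- a is valid, then G, which lies in the value
    of [tau G], lies in the value of a, that is, G |-- a is derivable.

    Subformula property: passing from the conclusion of a rule to a premise
    introduces only subformulas.  The exception is a structural rule of Psi: its
    variables cause no loss, by the inclusion of variables, so only a constant of
    the succedent may be new. *)

(** * Soundness *)

Section Soundness.
Context (d : Order.disp_t) (A : bdrgType d).
Implicit Types (a b x y : A) (mu : nat -> A).

Lemma fuse_le2 a b x y :
  (a <= b)%O -> (x <= y)%O -> (fuse a x <= fuse b y)%O.
Proof.
move=> ab xy; apply: (@le_trans _ _ (fuse b x)).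
  by rewrite le_fuse_over (le_trans ab)// -le_fuse_over.
by rewrite le_fuse_under (le_trans xy)// -le_fuse_under.
Qed.

Lemma fuse_joinl_le a b x :
  (fuse (Order.join a b) x <= Order.join (fuse a x) (fuse b x))%O.
Proof.
by rewrite le_fuse_over leUx -!le_fuse_over leUl leUr.
Qed.

Lemma fuse_joinr_le x a b :
  (fuse x (Order.join a b) <= Order.join (fuse x a) (fuse x b))%O.
Proof.
by rewrite le_fuse_under leUx -!le_fuse_under leUl leUr.
Qed.

Lemma eval_plug_le mu C G D :
  (eval mu (tau G) <= eval mu (tau D))%O ->
  (eval mu (tau (plug C G)) <= eval mu (tau (plug C D)))%O.
Proof.
move=> GD; elim: C => //= [C IH E|E C IH|C IH E|E C IH].
- exact: fuse_le2.
- exact: fuse_le2.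
- exact: leI2.
- exact: leI2.
Qed.

Lemma eval_plug_bot_le mu C x : (eval mu (tau (plug C Bot)) <= x)%O.
Proof.
elim: C x => /= [|C IH E|E C IH|C IH E|E C IH] x; first exact: le0x.
- by rewrite le_fuse_over.
- by rewrite le_fuse_under.
- exact: leIxl.
- exact: leIxr.
Qed.

Lemma eval_plug_join_le mu C G D E :
  (eval mu (tau G) <= Order.join (eval mu (tau D)) (eval mu (tau E)))%O ->
  (eval mu (tau (plug C G)) <=
     Order.join (eval mu (tau (plug C D))) (eval mu (tau (plug C E))))%O.
Proof.
move=> GDE; elim: C => //= [C IH F|F C IH|C IH F|F C IH].
- exact: le_trans (fuse_le2 IH (lexx _)) (fuse_joinl_le _ _ _).
- exact: le_trans (fuse_le2 (lexx _) IH) (fuse_joinr_le _ _ _).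
- by rewrite -meetUl leI2.
- by rewrite -meetUr leI2.
Qed.

Lemma eval_bsubst mu S (x : bformula) :
  eval mu (tau (bsubst S x)) =
  eval (fun n => eval mu (tau (S n))) (formula_of x).
Proof. by elim: x => //= x -> y ->. Qed.

Lemma rule_sound Psi ps c : in_Alg Psi A -> rule Psi ps c ->
  (forall p, List.In p ps -> valid_in A p) -> valid_in A c.
Proof.
move=> APsi; case=> {ps c} [a|G|C a|C D a b c|G a b|C D a b c|G a b|C a b c
  |G D a b|C a b c|G D a b|C a b c|G a b|G a b|C D c|C D E c|C D E c
  |C D1 D2 D3 c|s C S c Ps] prem mu /=.
- exact: lexx.
- exact: lex1.
- exact: eval_plug_bot_le.
- have /(_ mu) /= Da := prem _ (or_introl erefl).
  have /(_ mu) /= := prem _ (or_intror (or_introl erefl)).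
  apply: le_trans; apply: eval_plug_le => /=.
  by apply: le_trans (fuse_le2 Da (lexx _)) _; rewrite le_fuse_under.
- have /(_ mu) /= := prem _ (or_introl erefl).
  by rewrite le_fuse_under.
- have /(_ mu) /= Db := prem _ (or_intror (or_introl erefl)).
  have /(_ mu) /= := prem _ (or_introl erefl).
  apply: le_trans; apply: eval_plug_le => /=.
  by apply: le_trans (fuse_le2 (lexx _) Db) _; rewrite le_fuse_over.
- have /(_ mu) /= := prem _ (or_introl erefl).
  by rewrite le_fuse_over.
- have /(_ mu) /= := prem _ (or_introl erefl).
  by apply: le_trans; apply: eval_plug_le.
- apply: fuse_le2; first exact: (prem _ (or_introl erefl) mu).
  exact: (prem _ (or_intror (or_introl erefl)) mu).
- have /(_ mu) /= := prem _ (or_introl erefl).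
  by apply: le_trans; apply: eval_plug_le.
- apply: leI2; first exact: (prem _ (or_introl erefl) mu).
  exact: (prem _ (or_intror (or_introl erefl)) mu).
- have /(_ mu) /= ac := prem _ (or_introl erefl).
  have /(_ mu) /= bc := prem _ (or_intror (or_introl erefl)).
  apply: (@le_trans _ _ (Order.join (eval mu (tau (plug C a)))
                                    (eval mu (tau (plug C b))))).
    exact: eval_plug_join_le.
  by rewrite leUx ac.
- apply: le_trans (leUl _ _); exact: (prem _ (or_introl erefl) mu).
- apply: le_trans (leUr _ _); exact: (prem _ (or_introl erefl) mu).
- have /(_ mu) /= := prem _ (or_introl erefl).
  by apply: le_trans; apply: eval_plug_le; rewrite /= meetxx.
- have /(_ mu) /= := prem _ (or_introl erefl).
  by apply: le_trans; apply: eval_plug_le; rewrite /= leIr.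
- have /(_ mu) /= := prem _ (or_introl erefl).
  by apply: le_trans; apply: eval_plug_le; rewrite /= meetC.
- have /(_ mu) /= := prem _ (or_introl erefl).
  by apply: le_trans; apply: eval_plug_le; rewrite /= meetA.
- have /(_ mu) /= := prem _ (or_introl erefl).
  apply: le_trans; apply: eval_plug_le.
  by rewrite !eval_bsubst; apply: APsi.
Qed.

Lemma derivation_sound Psi c : in_Alg Psi A -> derivation Psi c -> valid_in A c.
Proof.
move=> APsi; elim=> {c} [c r|c c1 r _ IH1|c c1 c2 r _ IH1 _ IH2].
- exact: (rule_sound APsi r).
- by apply: (rule_sound APsi r) => p [<-|[]].
- by apply: (rule_sound APsi r) => p [<-|[<-|[]]].
Qed.

End Soundness.

(** * Closed sets of structures *)

Lemma derivable0 Psi c : rule Psi [::] c -> derivable Psi c.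
Proof. by move=> r; exact: inhabits (Infer0 r). Qed.

Lemma derivable1 Psi c c1 : rule Psi [:: c1] c ->
  derivable Psi c1 -> derivable Psi c.
Proof. by move=> r [d]; exact: inhabits (Infer1 r d). Qed.

Lemma derivable2 Psi c c1 c2 : rule Psi [:: c1; c2] c ->
  derivable Psi c1 -> derivable Psi c2 -> derivable Psi c.
Proof. by move=> r [d1] [d2]; exact: inhabits (Infer2 r d1 d2). Qed.

(** Composition of contexts: [C] with its hole filled by [D]. *)
Fixpoint ccomp (C D : context) : context :=
  match C with
  | Hole => D
  | CFuseL C G => CFuseL (ccomp C D) G
  | CFuseR G C => CFuseR G (ccomp C D)
  | CMeetL C G => CMeetL (ccomp C D) G
  | CMeetR G C => CMeetR G (ccomp C D)
  end.

Lemma plug_ccomp C D G : plug (ccomp C D) G = plug C (plug D G).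
Proof. by elim: C => //= [C -> E|E C ->|C -> E|E C ->]. Qed.

(** The closure of a set [X] of structures: the structures that may replace the
    members of [X] in every context and for every succedent for which all members
    of [X] yield a derivable consecution.  It is the closure operator of the
    Galois connection between structures and pairs of a context and a formula
    given by derivability. *)
Definition clos (Psi : bsequent -> Prop) (X : structure -> Prop)
    (z : structure) : Prop :=
  forall C (a : formula),
    (forall y, X y -> derivable Psi (plug C y |-- a)) ->
    derivable Psi (plug C z |-- a).

Lemma clos_in Psi (X : structure -> Prop) z : X z -> clos Psi X z.
Proof. by move=> Xz C a; apply. Qed.

(** The closure is compatible with contexts, hence a nucleus for both structural
    connectives; the empty context gives monotonicity and idempotence. *)
Lemma clos_plug Psi (X Y : structure -> Prop) D z :
  (forall x, X x -> clos Psi Y (plug D x)) ->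
  clos Psi X z -> clos Psi Y (plug D z).
Proof.
move=> XY Xz C a YC; rewrite -plug_ccomp; apply: Xz => y /XY.
by rewrite plug_ccomp; apply.
Qed.

(** The fixed points of the closure: the carrier of the algebra that refutes the
    underivable consecutions. *)
Record closed_set (Psi : bsequent -> Prop) := ClosedSet {
  elements :> structure -> Prop;
  closed_elements : forall z, clos Psi elements z -> elements z
}.

(* Equality and choice are classical, closed sets having no computable ones. *)
HB.instance Definition _ (Psi : bsequent -> Prop) :=
  gen_eqMixin (closed_set Psi).
HB.instance Definition _ (Psi : bsequent -> Prop) :=
  gen_choiceMixin (closed_set Psi).

Section ClosedSets.
Variable Psi : bsequent -> Prop.
Implicit Types (X Y Z : closed_set Psi) (P : structure -> Prop).

Lemma closed_set_ext X Y : (forall z, X z <-> Y z) -> X = Y.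
Proof.
case: X Y => [X cX] [Y cY] /= /predeqP XY; case: _ / XY cY => cY.
by congr ClosedSet; apply: Prop_irrelevance.
Qed.

Lemma closed_plug P Y D z : (forall x, P x -> Y (plug D x)) ->
  clos Psi P z -> Y (plug D z).
Proof.
move=> PY Pz; apply/closed_elements/(clos_plug _ Pz) => x /PY.
exact: clos_in.
Qed.

(** A closed set containing [y] contains [z] when [z] may replace [y] in every
    derivable consecution, as when a left or structural rule with one premise
    replaces [y] by [z]. *)
Lemma closed_step Y y z :
  (forall C a, derivable Psi (plug C y |-- a) -> derivable Psi (plug C z |-- a)) ->
  Y y -> Y z.
Proof.
by move=> yz Yy; apply: closed_elements => C a YC; apply/yz/YC.
Qed.

Lemma closed_bot Y : Y Bot.
Proof. by apply: closed_elements => C a _; apply/derivable0/R_bot. Qed.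

Lemma closed_SMeetl X x y : X x -> X (SMeet x y).
Proof.
apply: closed_step => C a /(derivable1 (R_weakening Psi C x y a)).
exact/derivable1/R_exchange.
Qed.

Lemma closed_SMeetr X x y : X y -> X (SMeet x y).
Proof. by apply: closed_step => C a; exact/derivable1/R_weakening. Qed.

Lemma closed_contract X x : X (SMeet x x) -> X x.
Proof. by apply: closed_step => C a; exact/derivable1/R_contraction. Qed.

Lemma clos_closed P z : clos Psi (clos Psi P) z -> clos Psi P z.
Proof. exact: (@clos_plug Psi _ _ Hole). Qed.

(** The least closed set containing [P]. *)
Definition closure P : closed_set Psi := ClosedSet (@clos_closed P).

Lemma closure_sub P Y : (forall x, P x -> Y x) -> forall z, closure P z -> Y z.
Proof. by move=> PY z; exact: (@closed_plug _ _ Hole). Qed.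

Lemma closed_meet_subproof X Y z :
  clos Psi (fun x => X x /\ Y x) z -> X z /\ Y z.
Proof.
by move=> XYz; split; apply: (closed_plug (D := Hole) _ XYz) => x [].
Qed.

Lemma closed_under_subproof X Y z :
  clos Psi (fun y => forall x, X x -> Y (SFuse x y)) z ->
  forall x, X x -> Y (SFuse x z).
Proof.
by move=> Uz x Xx; apply: (closed_plug (D := CFuseR x Hole) _ Uz) => y; apply.
Qed.

Lemma closed_over_subproof X Y z :
  clos Psi (fun x => forall y, Y y -> X (SFuse x y)) z ->
  forall y, Y y -> X (SFuse z y).
Proof.
by move=> Uz y Yy; apply: (closed_plug (D := CFuseL Hole y) _ Uz) => x; apply.
Qed.

(** The operations of the algebra: meets and residuals of closed sets are closed
    as they stand, while joins, the bottom element and fusions have to be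
    closed. *)
Definition closed_top : closed_set Psi :=
  @ClosedSet Psi (fun=> True) (fun _ _ => I).
Definition closed_bottom : closed_set Psi := closure (fun=> False).
Definition closed_meet X Y : closed_set Psi :=
  ClosedSet (@closed_meet_subproof X Y).
Definition closed_join X Y : closed_set Psi := closure (fun z => X z \/ Y z).
Definition closed_fuse X Y : closed_set Psi :=
  closure (fun z => exists x y, [/\ X x, Y y & z = SFuse x y]).
Definition closed_under X Y : closed_set Psi :=
  ClosedSet (@closed_under_subproof X Y).
Definition closed_over X Y : closed_set Psi :=
  ClosedSet (@closed_over_subproof X Y).

(** Inclusion, reflected classically as a boolean. *)
Definition closed_le X Y : bool := `[< forall z, X z -> Y z >].

Lemma closed_le_refl : reflexive closed_le.
Proof. by move=> X; apply/asboolP. Qed.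

Lemma closed_le_anti : antisymmetric closed_le.
Proof.
move=> X Y /andP[/asboolP XY /asboolP YX]; apply: closed_set_ext => z.
by split; [exact: XY | exact: YX].
Qed.

Lemma closed_le_trans : transitive closed_le.
Proof.
by move=> Y X Z /asboolP XY /asboolP YZ; apply/asboolP => z /XY /YZ.
Qed.

Lemma closed_lexI X Y Z :
  closed_le X (closed_meet Y Z) = closed_le X Y && closed_le X Z.
Proof.
apply/asboolP/andP => [H|[/asboolP XY /asboolP XZ] z Xz].
  by split; apply/asboolP => z /H [].
by split; [exact: XY | exact: XZ].
Qed.

Lemma closed_leUx X Y Z :
  closed_le (closed_join X Y) Z = closed_le X Z && closed_le Y Z.
Proof.
apply/asboolP/andP => [H|[/asboolP XZ /asboolP YZ]].
  by split; apply/asboolP => z ?; apply/H/clos_in; [left | right].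
by apply: closure_sub => z [/XZ|/YZ].
Qed.

(** Distributivity: by contraction, a member [z] of the meet of a join with [Z] may
    be replaced by [SMeet z z]; its first copy may be taken among the generators
    of the join, and weakening puts each resulting structure in both sets of a
    meet. *)
Lemma closed_set_meetUl : left_distributive closed_meet closed_join.
Proof.
move=> X Y Z; apply: closed_set_ext => z; split=> [[XYz Zz]|].
  apply: closed_contract.
  apply: (closed_plug (D := CMeetL Hole z) _ XYz) => x /= [Xx|Yx].
    apply: clos_in; left; split; first exact: closed_SMeetl.
    exact: closed_SMeetr.
  apply: clos_in; right; split; first exact: closed_SMeetl.
  exact: closed_SMeetr.
apply: closure_sub => x [[Xx Zx]|[Yx Zx]]; split=> //; apply: clos_in.
  by left.
by right.
Qed.

Lemma closed_set_le_fuse_under X Y Z :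
  closed_le (closed_fuse X Y) Z = closed_le Y (closed_under X Z).
Proof.
apply/asboolP/asboolP => [H y Yy x Xx|H].
  by apply/H/clos_in; exists x, y.
by apply: closure_sub => _ [x [y [Xx Yy ->]]]; exact: H.
Qed.

Lemma closed_set_le_fuse_over X Y Z :
  closed_le (closed_fuse X Y) Z = closed_le X (closed_over Z Y).
Proof.
apply/asboolP/asboolP => [H x Xx y Yy|H].
  by apply/H/clos_in; exists x, y.
by apply: closure_sub => _ [x [y [Xx Yy ->]]]; exact: H.
Qed.

Lemma closed_le0x X : closed_le closed_bottom X.
Proof. by apply/asboolP; apply: closure_sub. Qed.

Lemma closed_lex1 X : closed_le X closed_top.
Proof. exact/asboolP. Qed.

End ClosedSets.

Definition closed_display : Order.disp_t := Order.Disp tt tt.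

HB.instance Definition _ (Psi : bsequent -> Prop) :=
  Order.Le_isPOrder.Build closed_display (closed_set Psi)
    (@closed_le_refl Psi) (@closed_le_anti Psi) (@closed_le_trans Psi).
HB.instance Definition _ (Psi : bsequent -> Prop) :=
  Order.POrder_MeetJoin_isLattice.Build closed_display (closed_set Psi)
    (@closed_lexI Psi) (@closed_leUx Psi).
HB.instance Definition _ (Psi : bsequent -> Prop) :=
  Order.Lattice_Meet_isDistrLattice.Build closed_display (closed_set Psi)
    (@closed_set_meetUl Psi).
HB.instance Definition _ (Psi : bsequent -> Prop) :=
  Order.hasBottom.Build closed_display (closed_set Psi) (@closed_le0x Psi).
HB.instance Definition _ (Psi : bsequent -> Prop) :=
  Order.hasTop.Build closed_display (closed_set Psi) (@closed_lex1 Psi).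
HB.instance Definition _ (Psi : bsequent -> Prop) :=
  isResiduatedGroupoid.Build closed_display (closed_set Psi)
    (@closed_set_le_fuse_under Psi) (@closed_set_le_fuse_over Psi).

Lemma closed_set_leP Psi (X Y : closed_set Psi) :
  reflect (forall z, X z -> Y z) (X <= Y)%O.
Proof. exact: asboolP. Qed.

(** * Completeness *)

Lemma bsubst_eq_in S1 S2 x : {in bvars x, S1 =1 S2} ->
  bsubst S1 x = bsubst S2 x.
Proof.
elim: x => //= [n|x IHx y IHy] S12; first by rewrite S12 ?mem_head.
by rewrite IHx ?IHy// => n nx; apply: S12; rewrite mem_cat nx ?orbT.
Qed.

Section Completeness.
Variable Psi : bsequent -> Prop.
Implicit Types (nu : nat -> closed_set Psi) (S : nat -> structure).

Lemma mem_eval_bsubst nu S x : (forall n, nu n (S n)) ->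
  eval nu (formula_of x) (bsubst S x).
Proof.
move=> nuS; elim: x => [n|||x IHx y IHy] /=.
- exact: nuS.
- exact: I.
- exact: (closed_bot (closed_bottom Psi)).
- by apply: clos_in; exists (bsubst S x), (bsubst S y).
Qed.

(** The value of [x] is generated by the substitution instances of [x].  The
    substitutions found for the two factors of a fusion are merged into one,
    linearity making their variables disjoint.  The value of [Bot] is the closure
    of the empty set, so [Bot] causes no trouble; the value of [Top] contains all
    structures, which need not be in the closure of the sole instance [Top],
    hence the second hypothesis. *)
Lemma eval_antecedent_clos nu x : uniq (bvars x) ->
  ~ subformula Top (formula_of x) -> forall z, eval nu (formula_of x) z ->
  clos Psi (fun y => exists2 S, (forall n, nu n (S n)) & y = bsubst S x) z.
Proof.
elim: x => [n _ _ z nz| _ []|_ _|x IHx y IHy] /=.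
(* Variables other than [n] are sent to [Bot], a member of every closed set. *)
- apply: clos_in; exists (fun m => if m == n then z else SForm Bot).
    by move=> m; case: eqP => [->//|_]; exact: closed_bot.
  by rewrite eqxx.
- by left.
- by move=> z; apply: (@closure_sub _ _ (closure Psi _)).
rewrite cat_uniq => /and3P[ux /hasPn xy uy] noTop.
have {}IHx := IHx ux (fun h => noTop (or_intror (or_introl h))).
have {}IHy := IHy uy (fun h => noTop (or_intror (or_intror h))).
move=> z; apply: (@closure_sub _ _ (closure Psi _)) => _
  [u [v [/IHx xu /IHy yv ->]]].
apply: (clos_plug (D := CFuseL Hole v) _ xu) => _ [S1 nuS1 ->] /=.
apply: (clos_plug (D := CFuseR (bsubst S1 x) Hole) _ yv) => _ [S2 nuS2 ->] /=.
apply: clos_in; exists (fun n => if n \in bvars x then S1 n else S2 n).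
  by move=> n; case: ifP.
congr SFuse; apply: bsubst_eq_in => n nin; first by rewrite nin.
by rewrite (negbTE (xy _ nin)).
Qed.

(** The only use of the rules [R_struct]: they carry each instance of an antecedent
    into the value of the succedent, which contains the corresponding instance of
    the succedent even for variables absent from the antecedent. *)
Lemma closed_sets_in_Alg : (forall s, Psi s -> good s) ->
  (forall s, Psi s -> ~ subformula Top (formula_of (bant s))) ->
  in_Alg Psi (closed_set Psi : bdrgType closed_display).
Proof.
move=> gPsi noTop s Ps nu; apply/closed_set_leP => z /=.
move=> /(eval_antecedent_clos (gPsi s Ps) (noTop s Ps)).
apply: (@closure_sub _ _ (eval nu (formula_of (bsuc s)))) => _ [S nuS ->].
apply: closed_step (mem_eval_bsubst (bsuc s) nuS) => C a.
exact/derivable1/R_struct.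
Qed.

Lemma antecedents_closed a z :
  clos Psi (fun G => derivable Psi (G |-- a)) z -> derivable Psi (z |-- a).
Proof. by move/(_ Hole a); apply. Qed.

(** The principal closed set of [a]: all structures that derive [a]. *)
Definition antecedents (a : formula) : closed_set Psi :=
  ClosedSet (@antecedents_closed a).

(** Each variable denotes the set of structures that derive it. *)
Definition canonical_assignment (n : nat) : closed_set Psi :=
  antecedents (Var n).

(** The left rules give membership of [a]; the right rules give inclusion in
    [antecedents a]. *)
Lemma truth_lemma a :
  eval canonical_assignment a a /\
  forall z, eval canonical_assignment a z -> antecedents a z.
Proof.
elim: a => [n|||a [aa ua] b [bb ub]|a [aa ua] b [bb ub]|a [aa ua] b [bb ub]
  |a [aa ua] b [bb ub]|a [aa ua] b [bb ub]].
- by split=> //; apply/derivable0/R_id.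
- by split=> // z _; apply/derivable0/R_top.
- split; first exact: (closed_bot (closed_bottom Psi)).
  by apply: closure_sub.
- split.
    apply: (@closed_step _ _ (SMeet a b)).
      by move=> C c; exact/derivable1/R_andL.
    by split; [exact: closed_SMeetl | exact: closed_SMeetr].
  move=> z [/ua za /ub zb]; apply: closed_contract.
  exact: derivable2 (R_andR Psi z z a b) za zb.
- split.
    move=> C c H; apply: derivable2 (R_orL Psi C a b c) _ _; apply: H.
      by left.
    by right.
  apply: closure_sub => z [/ua|/ub].
    exact/derivable1/R_orR1.
  exact/derivable1/R_orR2.
- split.
    move=> x /ua xa; apply: closed_elements => C c H.
    exact: derivable2 (R_underL Psi C x a b c) xa (H _ bb).
  by move=> z /(_ _ aa) /ub; exact/derivable1/R_underR.
- split.
    apply: (@closed_step _ _ (SFuse a b)).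
      by move=> C c; exact/derivable1/R_fuseL.
    by apply: clos_in; exists a, b.
  apply: closure_sub => _ [x [y [/ua xa /ub yb ->]]].
  exact: derivable2 (R_fuseR Psi x y a b) xa yb.
- split.
    move=> y /ub yb; apply: closed_elements => C c H.
    exact: derivable2 (R_overL Psi C y a b c) (H _ aa) yb.
  by move=> z /(_ _ bb) /ua; exact/derivable1/R_overR.
Qed.

(** Every structure belongs to the value of its own translation. *)
Lemma mem_eval_tau G : eval canonical_assignment (tau G) G.
Proof.
elim: G => /= [a|G IHG D IHD|G IHG D IHD].
- by case: (truth_lemma a).
- by apply: clos_in; exists G, D.
- by split; [exact: closed_SMeetl | exact: closed_SMeetr].
Qed.

Lemma valid_in_closed_sets_derivable c :
  valid_in (closed_set Psi : bdrgType closed_display) c -> derivable Psi c.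
Proof.
case: c => G a /(_ canonical_assignment) /closed_set_leP /(_ _ (mem_eval_tau G)).
by case: (truth_lemma a) => _; apply.
Qed.

End Completeness.

(** * Subformula property *)

Lemma subformula_refl a : subformula a a.
Proof. by case: a => *; left. Qed.

Lemma subformula_trans a b c :
  subformula a b -> subformula b c -> subformula a c.
Proof.
move=> ab; elim: c => [n|||c1 IH1 c2 IH2|c1 IH1 c2 IH2|c1 IH1 c2 IH2
  |c1 IH1 c2 IH2|c1 IH1 c2 IH2] [<-|] //=.
all: by move=> [/IH1|/IH2]; tauto.
Qed.

Lemma occurs_plug a C D : occurs_in_structure a D ->
  occurs_in_structure a (plug C D).
Proof. by move=> aD; elim: C => //= [C IH E|E C IH|C IH E|E C IH]; tauto. Qed.

(** A formula occurring in [plug C D] occurs in [D] or in the context [C]; the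
    latter is expressed by filling the hole with arbitrary structures. *)
Lemma occurs_plugP a C D : occurs_in_structure a (plug C D) ->
  occurs_in_structure a D \/ forall E, occurs_in_structure a (plug C E).
Proof.
elim: C => /= [|C IH F|F C IH|C IH F|F C IH]; first by left.
- by case=> [/IH[|aC]|aF]; [left | right=> E; left | right=> E; right].
- by case=> [aF|/IH[|aC]]; [right=> E; left | left | right=> E; right].
- by case=> [/IH[|aC]|aF]; [left | right=> E; left | right=> E; right].
- by case=> [aF|/IH[|aC]]; [right=> E; left | left | right=> E; right].
Qed.

Lemma occurs_bsubst_var a S n x : n \in bvars x ->
  occurs_in_structure a (S n) -> occurs_in_structure a (bsubst S x).
Proof.
elim: x => //= [m|x IHx y IHy]; first by rewrite inE => /eqP ->.
by rewrite mem_cat => /orP[/IHx|/IHy] H /H; [left | right].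
Qed.

Lemma occurs_bsubst_const a S x : a = Top \/ a = Bot ->
  subformula a (formula_of x) -> occurs_in_structure a (bsubst S x).
Proof.
move=> aTB; elim: x => /= [n|[]|[]|x IHx y IHy] //.
  by case=> // an; case: aTB; rewrite an.
by case=> [an|[/IHx|/IHy]]; [case: aTB; rewrite an | left | right].
Qed.

Lemma occurs_bsubstP a S x : occurs_in_structure a (bsubst S x) ->
  (exists2 n, n \in bvars x & occurs_in_structure a (S n)) \/
  ((a = Top \/ a = Bot) /\ subformula a (formula_of x)).
Proof.
elim: x => /= [n aS|->|->|x IHx y IHy].
- by left; exists n; rewrite ?mem_head.
- by right; split; left.
- by right; split; [right | left].
case=> [/IHx|/IHy] [[n nx aS]|[aTB sub]].
- by left; exists n; rewrite // mem_cat nx.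
- by right; split=> //; right; left.
- by left; exists n; rewrite // mem_cat nx orbT.
- by right; split=> //; right; right.
Qed.

(** The subformula property of a single rule: a formula of a premise [p] is a
    subformula of the conclusion [c], or a constant lost by a structural rule. *)
Lemma rule_subformula Psi ps (c p : consecution) a :
  (forall s, Psi s -> {subset bvars (bsuc s) <= bvars (bant s)}) ->
  rule Psi ps c -> List.In p ps -> occurs_in_consecution a p ->
  subformula_of_consecution a c \/ vanishing_constant Psi a.
Proof.
move=> vPsi; have refl := subformula_refl.
(* Rules replacing [D] by [E] in a context: only the formulas of [D] matter. *)
have ctx C D E (f : formula) : occurs_in_consecution a (plug C D |-- f) ->
    (occurs_in_structure a D ->
       exists2 b, occurs_in_structure b E & subformula a b) ->
    subformula_of_consecution a (plug C E |-- f).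
  case=> /= [/occurs_plugP[aD /(_ aD) [b bE ab]|aC _]|-> _].
  - by exists b => //; left; exact: occurs_plug.
  - by exists a => //; left; exact: aC.
  - by exists f => //; right.
(* Rules acting on the succedent, with [e] active in the premise. *)
have ant G E (e f : formula) : occurs_in_consecution a (G |-- e) ->
    (occurs_in_structure a G ->
       occurs_in_structure a E \/ subformula a f) ->
    subformula e f -> subformula_of_consecution a (E |-- f).
  move=> aGe GE ef; have [aE|af] : occurs_in_structure a E \/ subformula a f.
    by case: aGe => /= [/GE|->]; [|right].
  - by exists a => //; left.
  - by exists f => //; right.
case=> {ps c} [e|G|C e|C D e f g|G e f|C D e f g|G e f|C e f g
  |G D e f|C e f g|G D e f|C e f g|G e f|G e f|C D g|C D E g|C D E g
  |C D1 D2 D3 g|s C S g Ps] //=.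
- case=> [<-|[<-|[]]] occ; left; last first.
    by apply: ctx occ _ => /= ->; exists (Under e f); [right | right; right].
  case: occ => /= [aD|->].
    by exists a => //; left; apply: occurs_plug; left.
  exists (Under e f); last by right; left.
  by left; apply: occurs_plug; right.
- case=> [<-|[]] occ; left; apply: ant occ _ _ => /=.
    by case=> [->|]; [right; right; left | left].
  by right; right.
- case=> [<-|[<-|[]]] occ; left.
    by apply: ctx occ _ => /= ->; exists (Over e f); [left | right; left].
  case: occ => /= [aD|->].
    by exists a => //; left; apply: occurs_plug; right.
  exists (Over e f); last by right; right.
  by left; apply: occurs_plug; left.
- case=> [<-|[]] occ; left; apply: ant occ _ _ => /=.
    by case=> [|->]; [left | right; right; right].
  by right; left.
- case=> [<-|[]] occ; left; apply: ctx occ _ => /= ae.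
  by exists (Fuse e f) => //; case: ae => ->; right; [left | right].
- case=> [<-|[<-|[]]] occ; left; apply: ant occ _ _ => /=.
  + by left; left.
  + by right; left.
  + by left; right.
  + by right; right.
- case=> [<-|[]] occ; left; apply: ctx occ _ => /= ae.
  by exists (And e f) => //; case: ae => ->; right; [left | right].
- case=> [<-|[<-|[]]] occ; left; apply: ant occ _ _ => /=.
  + by left; left.
  + by right; left.
  + by left; right.
  + by right; right.
- case=> [<-|[<-|[]]] occ; left; apply: ctx occ _ => /= ->;
    exists (Or e f) => //; right; [by left | by right].
- by case=> [<-|[]] occ; left; apply: ant occ _ _ => /=; [left | right; left].
- by case=> [<-|[]] occ; left; apply: ant occ _ _ => /=; [left | right; right].
- by case=> [<-|[]] occ; left; apply: ctx occ _ => /= aD; exists a => //; tauto.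
- by case=> [<-|[]] occ; left; apply: ctx occ _ => /= aD; exists a => //; tauto.
- by case=> [<-|[]] occ; left; apply: ctx occ _ => /= aD; exists a => //; tauto.
- by case=> [<-|[]] occ; left; apply: ctx occ _ => /= aD; exists a => //; tauto.
case=> [<-|[]] occ.
have [van|nvan] := pselect (vanishing_constant Psi a); [by right | left].
apply: ctx occ _ => /occurs_bsubstP[[n nin aS]|[aTB sub]]; exists a => //.
  exact: occurs_bsubst_var (vPsi s Ps n nin) aS.
apply: occurs_bsubst_const => //; apply: contrapT => nsub.
by apply: nvan; split=> //; exists s.
Qed.

Lemma subformula_of_consecution_trans a b c :
  subformula a b -> subformula_of_consecution b c ->
  subformula_of_consecution a c.
Proof. by move=> ab [e ec be]; exists e => //; exact: subformula_trans be. Qed.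

Lemma subformula_vanishing_constant Psi a b :
  subformula a b -> vanishing_constant Psi b -> vanishing_constant Psi a.
Proof.
by move=> ab vb; suff -> : a = b by []; case: vb ab => -[] -> _ /= [].
Qed.

Lemma occurs_in_derivation_subformula Psi c (d : derivation Psi c) a :
  (forall s, Psi s -> {subset bvars (bsuc s) <= bvars (bant s)}) ->
  occurs_in_derivation a d ->
  subformula_of_consecution a c \/ vanishing_constant Psi a.
Proof.
move=> vPsi.
have here (e : consecution) : occurs_in_consecution a e ->
    subformula_of_consecution a e \/ vanishing_constant Psi a.
  by move=> ae; left; exists a => //; exact: subformula_refl.
have step ps (e p : consecution) : rule Psi ps e -> List.In p ps ->
    subformula_of_consecution a p \/ vanishing_constant Psi a ->
    subformula_of_consecution a e \/ vanishing_constant Psi a.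
  move=> r pin [[b bp ab]|]; last by right.
  case: (rule_subformula vPsi r pin bp) => [be|bv].
    by left; exact: subformula_of_consecution_trans be.
  by right; exact: subformula_vanishing_constant bv.
elim: d => {c} /= [c r [/here//|[]]|c c1 r d1 IH [/here//|/IH]|].
  by apply: (step _ _ _ r); left.
move=> c c1 c2 r d1 IH1 d2 IH2 [/here//|[/IH1|/IH2]]; apply: (step _ _ _ r).
  by left.
by right; left.
Qed.

Theorem theorem14 (Psi : bsequent -> Prop) (hgood : forall s, Psi s -> good s) :
  (forall c, derivable Psi c -> Alg_entails Psi c)
  /\ ((forall s, Psi s -> ~ subformula Top (formula_of (bant s))) ->
      forall c, derivable Psi c <-> Alg_entails Psi c)
  /\ ((forall s, Psi s -> {subset bvars (bsuc s) <= bvars (bant s)}) ->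
      forall (c : consecution) (d : derivation Psi c) (a : formula),
        occurs_in_derivation a d ->
        subformula_of_consecution a c \/ vanishing_constant Psi a).
Proof.
have sound c : derivable Psi c -> Alg_entails Psi c.
  by move=> [der] d A APsi; exact: derivation_sound der.
split=> //; split=> [noTop c|vPsi c d a].
  split=> [|valid]; first exact: sound.
  apply: valid_in_closed_sets_derivable.
  exact/valid/closed_sets_in_Alg.
exact: occurs_in_derivation_subformula.
Qed.
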